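(* (i) Let $n\ge 3$. The complex algebra $\mathbb{O}_n$ is simple if and only if $n$ is not of the form $4m$, and the complex algebra $\mathbb{M}_n$ is simple if and only if $n$ is not of the form $4m+2$ ($m$ an integer). Moreover, for $m\ge1$, there are isomorphisms of complex algebras $\mathbb{O}_{4m}\cong\mathbb{O}_{4m-1}\oplus\mathbb{O}_{4m-1}$ and $\mathbb{M}_{4m+2}\cong\mathbb{M}_{4m+1}\oplus\mathbb{M}_{4m+1}$. (ii) Let $p,q\ge0$ with $p+q\ge3$. The real algebra $\mathbb{O}_{p,q}$ is simple if and only if one of the following holds: (1) $p+q$ is not of the form $4m$; (2) $p+q=4m$ for some integer $m$ and $p,q$ are odd. (iii) Let $p,q\ge0$ with $p+q\ge3$. The real algebra $\mathbb{M}_{p,q}$ is simple if and only if one of the following holds: (1) $p+q$ is not of the form $4m+2$; (2) $p+q=4m+2$ for some integer $m$ and $p,q$ are odd.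
   Context: For $\mathbb{K}=\mathbb{R}$ or $\mathbb{C}$ and $f:(\mathbb{Z}_2)^n\times(\mathbb{Z}_2)^n\to\mathbb{Z}_2$ with $f(0,\cdot)=f(\cdot,0)=0$, the twisted group algebra $(\mathbb{K}[(\mathbb{Z}_2)^n],f)$ is the $\mathbb{K}$-algebra with basis $u_x$, $x\in(\mathbb{Z}_2)^n$, and product $u_x\cdot u_y=(-1)^{f(x,y)}u_{x+y}$. Put $$f_{\mathbb{M}}(x,y)=\sum_{1\le i<j<k\le n}(x_ix_jy_k+x_iy_jx_k+y_ix_jx_k),\qquad f_{\mathbb{O}}(x,y)=f_{\mathbb{M}}(x,y)+\sum_{1\le i\le j\le n}x_iy_j .$$ Then $\mathbb{O}_n=(\mathbb{C}[(\mathbb{Z}_2)^n],f_{\mathbb{O}})$ and $\mathbb{M}_n=(\mathbb{C}[(\mathbb{Z}_2)^n],f_{\mathbb{M}})$. For $p+q=n$, $\mathbb{O}_{p,q}=(\mathbb{R}[(\mathbb{Z}_2)^n],\,f_{\mathbb{O}}+\sum_{1\le i\le p}x_iy_i)$ and $\mathbb{M}_{p,q}=(\mathbb{R}[(\mathbb{Z}_2)^n],\,f_{\mathbb{M}}+\sum_{1\le i\le p}x_iy_i)$. An algebra is simple if its only two-sided ideals (not necessarily graded) are $0$ and the algebra itself. *)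

(* Defs.v *)
From HB Require Import structures.
From mathcomp Require Import all_boot all_order all_algebra.
From mathcomp Require Import boolp classical_sets reals complex.

Set Implicit Arguments.
Unset Strict Implicit.
Unset Printing Implicit Defensive.

Import Order.TTheory GRing.Theory Num.Theory.

Local Open Scope classical_set_scope.
Local Open Scope ring_scope.

(* Neither associativity nor commutativity nor a unit is required: the algType
   hierarchy of MathComp only covers associative algebras. *)
HB.mixin Record Lmodule_isNonassocAlgebra (K : fieldType) A
    of GRing.Lmodule K A := {
  namul : A -> A -> A ;
  namul_linearl : forall b : A, linear (namul^~ b) ;
  namul_linearr : forall a : A, linear (namul a)
}.

#[short(type="nonassocAlgType")]
HB.structure Definition NonassocAlgebra (K : fieldType) :=
  {A of GRing.Lmodule K A & Lmodule_isNonassocAlgebra K A}.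

Record two_sided_ideal (K : fieldType) (A : nonassocAlgType K) (I : set A) :
    Prop := TwoSidedIdeal {
  ideal_zero : I 0 ;
  ideal_linear : forall (c : K) (a b : A), I a -> I b -> I (c *: a + b) ;
  ideal_namull : forall a b : A, I b -> I (namul a b) ;
  ideal_namulr : forall a b : A, I a -> I (namul a b)
}.

Definition simple_algebra (K : fieldType) (A : nonassocAlgType K) : Prop :=
  forall I : set A, two_sided_ideal I -> I = [set 0] \/ I = setT.

Definition algebra_isomorphic (K : fieldType) (A B : nonassocAlgType K) :
    Prop :=
  exists phi : {linear A -> B},
    bijective phi /\ forall a b : A, phi (namul a b) = namul (phi a) (phi b).

Section DirectSum.
Variables (K : fieldType) (A B : nonassocAlgType K).

Definition pair_namul (u v : A * B) : A * B :=
  (namul u.1 v.1, namul u.2 v.2).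

Fact pair_namul_linearl (v : A * B) : linear (pair_namul^~ v).
Proof.
by move=> c u w; rewrite /pair_namul /= !namul_linearl.
Qed.

Fact pair_namul_linearr (u : A * B) : linear (pair_namul u).
Proof.
by move=> c v w; rewrite /pair_namul /= !namul_linearr.
Qed.

HB.instance Definition _ := Lmodule_isNonassocAlgebra.Build K (A * B)%type
  pair_namul_linearl pair_namul_linearr.

End DirectSum.

(* The element a stands for \sum_x a x *: u_x; the twisting function f only
   matters for the product. *)
Definition twisted_group_algebra (K : fieldType) (n : nat)
    (f : 'rV['Z_2]_n -> 'rV['Z_2]_n -> 'Z_2) : Type :=
  {ffun 'rV['Z_2]_n -> K^o}.

Section TwistedGroupAlgebra.
Variables (K : fieldType) (n : nat) (f : 'rV['Z_2]_n -> 'rV['Z_2]_n -> 'Z_2).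

Local Notation A := (twisted_group_algebra K f).

HB.instance Definition _ := GRing.Lmodule.copy A {ffun 'rV['Z_2]_n -> K^o}.

Definition tga_basis (x : 'rV['Z_2]_n) : A := [ffun y => (y == x)%:R].

Definition tga_mul (a b : A) : A :=
  \sum_(x : 'rV['Z_2]_n) \sum_(y : 'rV['Z_2]_n)
    (a x * b y * (-1) ^+ nat_of_ord (f x y)) *: tga_basis (x + y).

Fact tga_mul_linearl (b : A) : linear (tga_mul^~ b).
Proof.
move=> c a a'; rewrite /tga_mul scaler_sumr -big_split; apply: eq_bigr => x _.
rewrite /= scaler_sumr -big_split; apply: eq_bigr => y _ /=.
by rewrite scalerA -scalerDl !ffunE !mulrDl !mulrA.
Qed.

Fact tga_mul_linearr (a : A) : linear (tga_mul a).
Proof.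
move=> c b b'; rewrite /tga_mul scaler_sumr -big_split; apply: eq_bigr => x _.
rewrite /= scaler_sumr -big_split; apply: eq_bigr => y _ /=.
by rewrite scalerA -scalerDl !ffunE mulrDr mulrDl [a x * (c *: _)]mulrCA !mulrA.
Qed.

HB.instance Definition _ := Lmodule_isNonassocAlgebra.Build K A
  tga_mul_linearl tga_mul_linearr.

Lemma tga_basis_decomp (a : A) : a = \sum_x (a x : K) *: tga_basis x.
Proof.
apply/ffunP => z; rewrite sum_ffunE (bigD1 z) //= big1 => [|x /negPf neq_xz].
  by rewrite !ffunE eqxx addr0 [_ *: _]mulr1.
by rewrite !ffunE eq_sym neq_xz scaler0.
Qed.

Lemma namul_tga_basis (x y : 'rV['Z_2]_n) :
  namul (tga_basis x) (tga_basis y)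
    = (-1) ^+ nat_of_ord (f x y) *: tga_basis (x + y).
Proof.
rewrite /namul /= /tga_mul (bigD1 x) //= [X in _ + X]big1 => [|x' /negPf neq].
  rewrite addr0 (bigD1 y) //= [X in _ + X]big1 => [|y' /negPf neq].
    by rewrite !ffunE !eqxx !mul1r addr0.
  by rewrite !ffunE neq mulr0 mul0r scale0r.
by apply: big1 => y' _; rewrite !ffunE neq !mul0r scale0r.
Qed.

End TwistedGroupAlgebra.

(* Coordinates are indexed by 'I_n, i.e., from 0 to n - 1; hence the condition
   i <= p on 1-based indices becomes i < p in twist_sig. *)
Definition twist_M (n : nat) (x y : 'rV['Z_2]_n) : 'Z_2 :=
  \sum_(i < n) \sum_(j < n | (i < j)%N) \sum_(k < n | (j < k)%N)
    (x 0 i * x 0 j * y 0 k + x 0 i * y 0 j * x 0 k + y 0 i * x 0 j * x 0 k).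

Definition twist_O (n : nat) (x y : 'rV['Z_2]_n) : 'Z_2 :=
  twist_M x y + \sum_(i < n) \sum_(j < n | (i <= j)%N) x 0 i * y 0 j.

Definition twist_sig (p n : nat) (x y : 'rV['Z_2]_n) : 'Z_2 :=
  \sum_(i < n | (i < p)%N) x 0 i * y 0 i.

Definition algO (R : realType) (n : nat) : nonassocAlgType R[i] :=
  twisted_group_algebra R[i] (@twist_O n).

Definition algM (R : realType) (n : nat) : nonassocAlgType R[i] :=
  twisted_group_algebra R[i] (@twist_M n).

Definition algOpq (R : realType) (p q : nat) : nonassocAlgType R :=
  twisted_group_algebra R
    (fun x y : 'rV['Z_2]_(p + q) => twist_O x y + twist_sig p x y).

Definition algMpq (R : realType) (p q : nat) : nonassocAlgType R :=
  twisted_group_algebra R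
    (fun x y : 'rV['Z_2]_(p + q) => twist_M x y + twist_sig p x y).

(* Main.v *)
Require Import Defs.
From HB Require Import structures.
From mathcomp Require Import all_boot all_order all_algebra.
From mathcomp Require Import boolp classical_sets reals complex.
From mathcomp Require Import ring zify.

(* Let f be additive in its second argument, with
   f(x,y) + f(y,x) = f(x+y,x+y) + f(x,x) + f(y,y), and call z radical when u_z
   commutes with all the u_x; by trilinearity of the polarization of f(x,x),
   such a u_z also associates with everything.  Up to a global sign,
   a |-> u_x (a u_x) multiplies the coefficient a_w by
   (-1)^(f(x,w) + f(w,x)), so averaging these operators shows that a nonzero
   ideal contains an element with a_0 <> 0 supported on the radical.  If the
   radical is 0, this element is a multiple of the unit u_0.  For the
   twists at hand f(x,x) depends only on the weight of x modulo 4, and the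
   radical is 0 or {0, 1} with 1 = (1,...,1).  In the latter case, either
   u_1^2 = -1, and over the reals a_0 + a_1 u_1 is invertible, or u_1^2 = 1,
   and the algebra is B + B u_1, with B spanned by the u_x such that x_0 = 0,
   and b + c u_1 |-> (b + c, b - c) is an isomorphism onto B x B. *)

Set Implicit Arguments.
Unset Strict Implicit.
Unset Printing Implicit Defensive.

Import Order.TTheory GRing.Theory Num.Theory.

Local Open Scope ring_scope.

(** * Arithmetic in characteristic 2 and signs *)

Lemma Z2P (a : 'Z_2) : a = 0 \/ a = 1.
Proof. by case: a => [[|[|//]] lt_a]; [left | right]; apply/val_inj. Qed.

Lemma addrr2 n (x : 'rV['Z_2]_n) : x + x = 0.
Proof.
by apply/rowP => i; rewrite !mxE; case: (Z2P (x 0 i)) => ->; apply/val_inj.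
Qed.

Lemma addrK2 n (y : 'rV['Z_2]_n) : involutive (+%R^~ y).
Proof. by move=> x; rewrite -addrA addrr2 addr0. Qed.

Lemma addr2_eq n (x y z : 'rV['Z_2]_n) : (x + z == y) = (x == y + z).
Proof. exact: can2_eq (addrK2 z) (addrK2 z) x y. Qed.

Section Sign.
Variable K : pzRingType.

Definition sgn2 (a : 'Z_2) : K := (-1) ^+ nat_of_ord a.

Lemma sgn2_0 : sgn2 0 = 1. Proof. exact: expr0. Qed.
Lemma sgn2_1 : sgn2 1 = -1. Proof. exact: expr1. Qed.

Lemma sgn2D (a b : 'Z_2) : sgn2 (a + b) = sgn2 a * sgn2 b.
Proof.
have s11 : sgn2 (1 + 1) = 1 by rewrite -sgn2_0; congr sgn2; apply/val_inj.
case: (Z2P a) (Z2P b) => -> [] ->;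
  rewrite ?add0r ?addr0 ?sgn2_0 ?mul1r ?mulr1 //.
by rewrite s11 sgn2_1 mulrNN mulr1.
Qed.

Lemma sgn2_sq (a : 'Z_2) : sgn2 a * sgn2 a = 1.
Proof. by case: (Z2P a) => ->; rewrite ?sgn2_0 ?sgn2_1 ?mulrNN mulr1. Qed.

End Sign.
Arguments sgn2 {K} a.

(** * Ideals and the radical *)

Section Bilinear.
Variables (K : fieldType) (A : nonassocAlgType K).
Implicit Types a b : A.

Lemma namulDl a a' b : namul (a + a') b = namul a b + namul a' b.
Proof. by have := namul_linearl b 1 a a'; rewrite !scale1r. Qed.

Lemma namulDr a b b' : namul a (b + b') = namul a b + namul a b'.
Proof. by have := namul_linearr a 1 b b'; rewrite !scale1r. Qed.

Lemma namul0l b : namul 0 b = 0 :> A.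
Proof. by apply: (addrI (namul 0 b)); rewrite -namulDl !addr0. Qed.

Lemma namul0r a : namul a 0 = 0.
Proof. by apply: (addrI (namul a 0)); rewrite -namulDr !addr0. Qed.

Lemma namulZl c a b : namul (c *: a) b = c *: namul a b.
Proof. by have := namul_linearl b c a 0; rewrite namul0l !addr0. Qed.

Lemma namulZr c a b : namul a (c *: b) = c *: namul a b.
Proof. by have := namul_linearr a c b 0; rewrite namul0r !addr0. Qed.

Lemma namul_suml (I : finType) (F : I -> A) b :
  namul (\sum_i F i) b = \sum_i namul (F i) b.
Proof. exact: (big_morph _ (fun a a' => namulDl a a' b) (namul0l b)). Qed.

Lemma namul_sumr (I : finType) (F : I -> A) a :
  namul a (\sum_i F i) = \sum_i namul a (F i).
Proof. exact: (big_morph _ (namulDr a) (namul0r a)). Qed.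

End Bilinear.

Section Twist.
Variables (n : nat) (f : 'rV['Z_2]_n -> 'rV['Z_2]_n -> 'Z_2).

Definition right_additive := forall x, {morph f x : y z / y + z}.

(** The commutation sign of [u_x] and [u_y] is the coboundary of the diagonal x |-> [f x x], so the
    diagonal alone decides which basis elements commute. *)
Definition polarized :=
  forall x y, f x y + f y x = f (x + y) (x + y) + f x x + f y y.

Definition radical z := forall x, f x z = f z x.

Hypothesis f_add : right_additive.

Lemma twist_x0 x : f x 0 = 0.
Proof. by apply: (addrI (f x 0)); rewrite -f_add !addr0. Qed.

Hypothesis f_pol : polarized.

Lemma twist_0x x : f 0 x = 0.
Proof.
have := f_pol x 0; rewrite !addr0 !twist_x0 add0r addr0 => ->.
by case: (Z2P (f x x)) => ->; apply/val_inj.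
Qed.

Section Algebra.
Variable K : numFieldType.
Local Notation A := (twisted_group_algebra K f).
Local Notation u := (tga_basis K f).
Implicit Types (a b : A).

Lemma tgaD a b w : (a + b : A) w = a w + b w. Proof. by rewrite ffunE. Qed.
Lemma tgaZ (c : K) a w : (c *: a : A) w = c * a w. Proof. by rewrite ffunE. Qed.

(** In characteristic 2 the equation x + y = w has the unique solution y = w + x, which makes the
    product a twisted convolution. *)
Lemma namulE a b w :
  namul a b w = \sum_x a x * b (w + x) * sgn2 (f x (w + x)) :> K.
Proof.
rewrite /namul /= /tga_mul sum_ffunE; apply: eq_bigr => x _.
rewrite sum_ffunE (bigD1 (w + x)) //= big1 => [|y neq_y]; rewrite !ffunE.
  by rewrite [x + _]addrC addrK2 eqxx addr0 [_ *: _]mulr1.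
suff /negPf-> : w != x + y by rewrite scaler0.
by apply: contra neq_y => /eqP->; rewrite [x + y]addrC addrK2.
Qed.

Lemma namul_basisl x a w : namul (u x) a w = a (w + x) * sgn2 (f x (w + x)) :>
  K.
Proof.
rewrite namulE (bigD1 x) //= big1 => [|y /negPf neq_y]; rewrite ffunE.
  by rewrite eqxx mul1r addr0.
by rewrite neq_y !mul0r.
Qed.

Lemma namul_basisr x a w : namul a (u x) w = a (w + x) * sgn2 (f (w + x) x) :>
  K.
Proof.
rewrite namulE (bigD1 (w + x)) //= big1 => [|y neq_y]; rewrite ffunE.
  by rewrite addrA addrr2 add0r eqxx mulr1 addr0.
rewrite [_ == x](_ : _ = false) ?mulr0 ?mul0r //.
by apply: contraNF neq_y => /eqP <-; rewrite addrA addrr2 add0r.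
Qed.

Lemma namul_basis0 a : namul a (u 0) = a.
Proof.
by apply/ffunP=> w; rewrite namul_basisr addr0 twist_x0 sgn2_0 mulr1.
Qed.

Lemma ideal_basis0 I : two_sided_ideal I -> I (u 0) -> I = setT :> set A.
Proof.
move=> [_ _ Il _] I1; rewrite -subTset => a _; rewrite -(namul_basis0 a).
exact: Il.
Qed.

Lemma ideal_radical (I : set A) :
    two_sided_ideal I -> I <> [set 0]%classic ->
  exists a, [/\ I a, a 0 != 0 & forall w, a w != 0 -> radical w].
Proof.
move=> [I0 Ilin Il Ir] In0.
have [a [Ia a0]] : exists a, I a /\ a 0 != 0.
  apply: contrapT => nex; apply: In0; apply/seteqP; split=> [a Ia|_ -> //].
  apply/ffunP=> y; rewrite ffunE; apply/eqP; apply: contrapT => /negP ay.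
  (* As y + y = 0, right multiplication by [u y] moves the coefficient at y to 0, up to a sign. *)
  apply: nex; exists (namul a (u y)); split; first exact: Ir.
  rewrite namul_basisr add0r mulf_neq0 //.
  by case: (Z2P (f y y)) => ->; rewrite ?sgn2_0 ?sgn2_1 ?oppr_eq0 oner_eq0.
pose chi x w : K := sgn2 (f x w + f w x).
(* Each factor 1 + [chi x w] is 2 or 0, and it is 0 exactly when [u_x] and [u_w] anticommute. Once
   [s] lists all x, only radical w survive. *)
pose proj s : A := [ffun w => (\prod_(x <- s) (1 + chi x w)) * a w].
have Iproj s : I (proj s).
  elim: s => [|x s IHs].
    suff -> : proj [::] = a by [].
    by apply/ffunP=> w; rewrite ffunE big_nil mul1r.
  (* The coefficient at w of u_x (b u_x) carries the exponent f(w,x) + f(x,w) + f(x,x); the scalar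
     [sgn2 (f x x)] removes the last term and leaves [chi x w]. *)
  have -> : proj (x :: s)
      = sgn2 (f x x) *: namul (u x) (namul (proj s) (u x)) + proj s.
    apply/ffunP=> w; rewrite ffunE big_cons tgaD tgaZ namul_basisl namul_basisr.
    rewrite addrK2 ffunE f_add !sgn2D -/(chi x w).
    set P := \prod_(_ <- _) _.
    rewrite mulrDl mul1r mulrDl [in RHS]addrC; congr (_ + _);
      rewrite /chi sgn2D.
    case: (Z2P (f x w)) (Z2P (f w x)) (Z2P (f x x)) => -> [] -> [] ->;
    by rewrite ?sgn2_0 ?sgn2_1 !(mulr1, mul1r, mulrN, mulNr, opprK).
  by apply: Ilin => //; apply: Il; apply: Ir.
exists (proj (enum 'rV['Z_2]_n)).
split=> [|| w]; first exact: Iproj.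
  (* At w = 0 every factor equals 2, which is nonzero in a [numFieldType]. *)
  rewrite ffunE mulf_neq0 // prodf_seq_neq0; apply/allP => x _ /=.
  by rewrite /chi twist_x0 twist_0x addr0 sgn2_0 (pnatr_eq0 K 2).
rewrite ffunE mulf_eq0 negb_or prodf_seq_neq0 => /andP[/allP chi_w _] x.
have := chi_w x; rewrite mem_enum => /(_ isT) /=; rewrite /chi.
case: (Z2P (f x w)) (Z2P (f w x)) => -> [] -> //;
  by rewrite ?addr0 ?add0r sgn2_1 subrr eqxx.
Qed.

Lemma simple_radical0 :
  (forall z, radical z -> z = 0) -> simple_algebra A.
Proof.
move=> rad0 I idI.
have [-> | /(ideal_radical idI)] := pselect (I = [set 0]%classic);
  first by left.
case=> a [Ia a0 rad_a]; right; apply: ideal_basis0 => //.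
suff -> : u 0 = (a 0)^-1 *: a + 0 by case: idI => I0 Ilin _ _; apply: Ilin.
apply/ffunP=> w; rewrite tgaD tgaZ !ffunE addr0.
have [->|/eqP w0] := eqVneq w 0; first by rewrite mulVf.
have [->|/rad_a/rad0] := eqVneq (a w) 0; by rewrite ?mulr0.
Qed.

(** Here [u_z] squares to -1, so a_0 + a_z u_z has norm a_0^2 + a_z^2; the hypothesis on squares
    makes this norm invertible when a_0 is nonzero. *)
Lemma simple_radical_sq z : f z z = 1 ->
    (forall x y : K, x != 0 -> x ^+ 2 + y ^+ 2 != 0) ->
    (forall w, radical w -> w = 0 \/ w = z) ->
  simple_algebra A.
Proof.
move=> zz1 sqK rad0z I idI.
have [-> | /(ideal_radical idI)] := pselect (I = [set 0]%classic);
  first by left.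
case=> a [Ia a0 rad_a]; right; apply: ideal_basis0 => //.
have z0 : z != 0 by apply/eqP => z0; rewrite z0 twist_x0 in zz1.
have a_supp w : w != 0 -> w != z -> a w = 0.
  move=> /eqP w0 /eqP wz; have [//|/rad_a/rad0z[]//] := eqVneq (a w) 0.
pose c : K := a 0 ^+ 2 + a z ^+ 2.
(* This is [a] times its conjugate a_0 - a_z u_z, divided by the norm [c]. The trailing 0 gives the
   sum the shape required by [ideal_linear]. *)
suff -> : u 0 = (c^-1 * a 0) *: a + (- (c^-1 * a z) *: namul a (u z) + 0).
  case: idI => I0 Ilin _ Ir; apply: (Ilin) => //; apply: (Ilin) => //;
    exact: Ir.
have c0 : c != 0 by apply: sqK.
apply/ffunP=> w; rewrite !(tgaD, tgaZ) namul_basisr !ffunE addr0 mulNr.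
have [->|w0] := eqVneq w 0.
  rewrite add0r zz1 sgn2_1 mulrN1 mulrN opprK -!mulrA -mulrDr -!expr2.
  by rewrite mulVf.
have [->|wz] := eqVneq w z.
  by rewrite addrr2 twist_0x sgn2_0 mulr1 mulrAC subrr.
rewrite !(a_supp w) ?(a_supp (w + z)) //; first 1 last.
- by rewrite addr2_eq add0r.
- by rewrite addr2_eq addrr2.
by rewrite mul0r !mulr0 subr0.
Qed.

Lemma tga_morph (B : nonassocAlgType K) (phi : {linear A -> B}) :
    (forall x y, phi (namul (u x) (u y)) = namul (phi (u x)) (phi (u y))) ->
  forall a b, phi (namul a b) = namul (phi a) (phi b).
Proof.
move=> phi_u a b; rewrite (tga_basis_decomp a) (tga_basis_decomp b).
rewrite [phi (\sum_x a x *: _)]linear_sum [phi (\sum_x b x *: _)]linear_sum.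
rewrite !namul_suml linear_sum; apply: eq_bigr => x _.
rewrite !namul_sumr linear_sum; apply: eq_bigr => y _.
by rewrite !(namulZl, namulZr) !linearZ /= !(namulZl, namulZr) phi_u.
Qed.
End Algebra.

(** Left additivity is not assumed of f, but adding a radical z shifts the diagonal by the constant
    [f z z] ([beta0]). The two shifts cancel in the polarization at (x + z, y), and right additivity
    does the rest. *)
Lemma radicalD z x y : radical z -> f (x + z) y = f x y + f z y.
Proof.
move=> rad_z.
have beta0 w : f (w + z) (w + z) = f w w + f z z.
  have := f_pol w z; rewrite rad_z.
  case: (Z2P (f z w)) (Z2P (f (w + z) (w + z))) (Z2P (f w w)) (Z2P (f z z))
    => -> [] -> [] -> [] ->; by move=> /(congr1 val) // _; apply/val_inj.
have := f_pol (x + z) y; have := f_pol x y.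
rewrite (addrAC x z y) !beta0 [f y (x + z)]f_add -(rad_z y).
case: (Z2P (f x y)) (Z2P (f y x)) (Z2P (f (x + y) (x + y))) (Z2P (f x x))
  => -> [] -> [] -> [] ->;
case: (Z2P (f y y)) (Z2P (f z z)) (Z2P (f y z)) (Z2P (f (x + z) y))
  => -> [] -> [] -> [] ->;
by move=> /(congr1 val) // _ /(congr1 val) // _; apply/val_inj.
Qed.

End Twist.

(** * Splitting along a radical element of square 1 *)

Section Split.
Variable n : nat.
Implicit Types (x y : 'rV['Z_2]_n.+1) (h k : 'rV['Z_2]_n).

Definition ones m : 'rV['Z_2]_m := const_mx 1.
Local Notation z := (ones n.+1).

Definition ext0 h : 'rV['Z_2]_n.+1 :=
  \row_j if unlift ord0 j is Some i then h 0 i else 0.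

(** Projection along [ones] onto the hyperplane x_0 = 0, which [ext0] identifies with the space of
    dimension n: the vector x + x_0 [ones] has coordinate 0 at index 0 and x_0 + x_i elsewhere. *)
Definition mod_ones x : 'rV['Z_2]_n := \row_i (x 0 ord0 + x 0 (lift ord0 i)).

Lemma ext0_ord0 h : ext0 h 0 ord0 = 0.
Proof. by rewrite mxE unlift_none. Qed.

Lemma ext0_lift h i : ext0 h 0 (lift ord0 i) = h 0 i.
Proof. by rewrite mxE liftK. Qed.

Lemma ext0D : {morph ext0 : h k / h + k}.
Proof.
by move=> h k; apply/rowP=> j; rewrite !mxE; case: unliftP => [i|] _;
  rewrite ?mxE ?addr0.
Qed.

Lemma mod_onesD : {morph mod_ones : x y / x + y}.
Proof. by move=> x y; apply/rowP=> j; rewrite !mxE addrACA. Qed.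

Lemma ext0K : cancel ext0 mod_ones.
Proof. by move=> h; apply/rowP=> j; rewrite mxE ext0_ord0 ext0_lift add0r. Qed.

Lemma mod_ones0 : mod_ones 0 = 0.
Proof. by apply/rowP => j; rewrite !mxE addr0. Qed.

Lemma ext00 : ext0 0 = 0.
Proof. by apply/rowP => j; rewrite !mxE; case: unliftP => *; rewrite ?mxE. Qed.

Lemma mod_ones_ones : mod_ones z = 0.
Proof. by apply/rowP => j; rewrite !mxE; apply/val_inj. Qed.

Lemma mod_ones_decomp x : ext0 (mod_ones x) + x 0 ord0 *: z = x.
Proof.
apply/rowP=> j; rewrite !mxE mulr1; case: unliftP => [i|] ->;
  rewrite ?mxE ?add0r //.
by case: (Z2P (x 0 ord0)) (Z2P (x 0 (lift ord0 i))) => -> [] ->; apply/val_inj.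
Qed.

Lemma ext0_eq h x : (ext0 h == x) = (x 0 ord0 == 0) && (h == mod_ones x).
Proof.
apply/eqP/andP=> [<-|[/eqP x0 /eqP->]]; first by rewrite ext0_ord0 ext0K !eqxx.
by rewrite -[RHS]mod_ones_decomp x0 scale0r addr0.
Qed.

Variable f : 'rV['Z_2]_n.+1 -> 'rV['Z_2]_n.+1 -> 'Z_2.

Definition restrict_twist h k := f (ext0 h) (ext0 k).
Local Notation g := restrict_twist.

Hypotheses (f_add : right_additive f) (f_pol : polarized f).
Hypotheses (rad_z : radical f z) (zz0 : f z z = 0).

(** Expand f(h + s z, k + t z) by right additivity and [radicalD]; the term in s t is a multiple of
    [f z z] = 0. *)
Lemma twist_split x y (s := x 0 ord0) (t := y 0 ord0)
    (h := ext0 (mod_ones x)) (k := ext0 (mod_ones y)) :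
  f x y = f h k + s * f k z + t * f h z.
Proof.
rewrite -{1}(mod_ones_decomp x) -{1}(mod_ones_decomp y) -/s -/t -/h -/k.
case: (Z2P s) (Z2P t) => -> [] ->;
by rewrite ?scale0r ?scale1r ?addr0 ?f_add ?radicalD // ?zz0 ?rad_z ?mul1r
  ?mul0r ?addr0 // addrAC.
Qed.

Variable K : numFieldType.
Local Notation A := (twisted_group_algebra K f).
Local Notation B := (twisted_group_algebra K g).

(** If x_0 = 1 and h = x + z, then u_x = (-1)^f(h,z) u_h u_z, and u_z is to be sent to (-1)^e. *)
Definition split_sign (e : 'Z_2) x := x 0 ord0 * (e + f (ext0 (mod_ones x)) z).

(* The quotient by the relation u_1 = (-1)^e. *)
Definition split_map (e : 'Z_2) (a : A) : B :=
  [ffun h => (a (ext0 h) : K) + sgn2 (e + f (ext0 h) z) * a (ext0 h + z)].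

Lemma split_map_linear e : linear (split_map e).
Proof.
move=> c a b; apply/ffunP=> h; rewrite !(tgaD, tgaZ, ffunE).
by rewrite !mulrDr addrACA !mulrA ![sgn2 _ * c]mulrC.
Qed.

HB.instance Definition _ e := GRing.isLinear.Build K A B _ (split_map e)
  (split_map_linear e).

Lemma split_map_basis e x :
  split_map e (tga_basis K f x) =
    sgn2 (split_sign e x) *: tga_basis K g (mod_ones x).
Proof.
apply/ffunP=> h; rewrite tgaZ !ffunE addr2_eq /split_sign.
rewrite !ext0_eq mod_onesD mod_ones_ones addr0.
rewrite [(x + z) 0 ord0]mxE [z 0 ord0]mxE.
case: (Z2P (x 0 ord0)) => ->; rewrite ?mul0r ?mul1r ?sgn2_0 /= ?add0r ?addr0.
by rewrite mulr0 addr0.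
by have [->|] := eqVneq h (mod_ones x);
  rewrite ?andbT ?andbF ?mulr0 ?mulr1 ?add0r.
Qed.

(** On basis elements this compares exponents: the mixed terms s f(k,z) + t f(h,z) from
    [twist_split] cancel those of [split_sign] at x + y. *)
Lemma split_map_mul e a b :
  split_map e (namul a b) = namul (split_map e a) (split_map e b).
Proof.
apply: (tga_morph (phi := split_map e)) => x y.
rewrite namul_tga_basis linearZ /= !split_map_basis namulZl namulZr
  namul_tga_basis.
rewrite -mod_onesD !scalerA -/(sgn2 _) -/(sgn2 _) -!sgn2D; congr (sgn2 _ *: _).
rewrite (twist_split x y) /split_sign mod_onesD ext0D [(x + y) 0 ord0]mxE /g.
set h := ext0 _; set k := ext0 _.
have -> : f (h + k) z = f h z + f k z by rewrite !rad_z f_add.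
set s := x 0 ord0; set t := y 0 ord0.
case: (Z2P s) (Z2P t) => -> [] ->; rewrite ?mul0r ?mul1r ?add0r ?addr0 ?mul0r
  ?mul1r ?addr0 //;
case: (Z2P e) (Z2P (f h k)) (Z2P (f h z)) (Z2P (f k z)) => -> [] -> [] -> [] ->;
exact/val_inj.
Qed.

(** The kernel of [split_map 0] is an ideal containing u_0 - u_z but not the unit u_0. *)
Lemma not_simple_split : ~ simple_algebra A.
Proof.
move=> simpleA; pose I : set A := [set a | split_map 0 a = 0]%classic.
have phi0 : split_map 0 (tga_basis K f 0) 0 = 1 :> K.
  rewrite split_map_basis /split_sign mxE mul0r sgn2_0 scale1r ffunE.
  by rewrite mod_ones0 eqxx.
have [I0|IT] : I = [set 0]%classic \/ I = setT.
- apply: simpleA; split=> [|c a b Ia Ib|a b Ib|a b Ia];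
  rewrite /I /= ?linear0 //.
  + by rewrite linearP /= Ia Ib scaler0 addr0.
  + by rewrite split_map_mul Ib namul0r.
  + by rewrite split_map_mul Ia namul0l.
- have: I (tga_basis K f 0 - tga_basis K f z).
    rewrite /I /= linearB /= !split_map_basis /split_sign !mxE mul0r mul1r.
    by rewrite mod_ones0 mod_ones_ones ext00 twist_0x // addr0 subrr.
  rewrite I0 => /ffunP/(_ 0); rewrite !ffunE eqxx.
  have /negPf-> : 0 != z by apply/eqP=> /rowP/(_ 0); rewrite !mxE.
  by move/eqP; rewrite oppr0 addr0 oner_eq0.
have: I (tga_basis K f 0) by rewrite IT.
move/ffunP/(_ 0); rewrite phi0 ffunE => /eqP; by rewrite oner_eq0.
Qed.

(** This is b (1 + u_z)/2 + c (1 - u_z)/2, built from the two complementary idempotents given by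
    u_z^2 = 1. *)
Definition split_merge (b c : B) : A :=
  [ffun x : 'rV['Z_2]_n.+1 => sgn2 (x 0 ord0 * f (ext0 (mod_ones x)) z)
    * ((b (mod_ones x) : K) + sgn2 (x 0 ord0) * c (mod_ones x)) / 2].

Lemma split_mapK a : split_merge (split_map 0 a) (split_map 1 a) = a.
Proof.
apply/ffunP=> x; rewrite !ffunE.
have := mod_ones_decomp x; move: (ext0 (mod_ones x)) => y.
case: (Z2P (x 0 ord0)) => ->; rewrite ?scale0r ?scale1r ?addr0 => <-.
  by rewrite mul0r !sgn2D sgn2_0 sgn2_1; field.
have := sgn2_sq K (f y z); rewrite mul1r !sgn2D sgn2_0 sgn2_1.
move: (sgn2 _) => s ss1.
(* The sign [s] enters only through its square, which is isolated so that [field] can treat [s] as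
   an indeterminate. *)
transitivity (s * s * a (y + z)); last by rewrite ss1 mul1r.
by field.
Qed.

Lemma split_mergeK b c :
  split_map 0 (split_merge b c) = b /\ split_map 1 (split_merge b c) = c.
Proof.
have vals h : [/\ (ext0 h + z) 0 ord0 = 1, mod_ones (ext0 h + z) = h
    & mod_ones (ext0 h) = h].
  by rewrite mod_onesD mod_ones_ones addr0 ext0K mxE ext0_ord0 mxE add0r.
split; apply/ffunP=> h; rewrite !ffunE; case: (vals h) => -> -> ->;
rewrite ext0_ord0 mul0r mul1r !sgn2D !sgn2_0 !sgn2_1;
have := sgn2_sq K (f (ext0 h) z); move: (sgn2 _) => s ss1.
  transitivity ((b h + c h + s * s * (b h - c h)) / 2); first by field.
  by rewrite ss1; field.
transitivity ((b h + c h - s * s * (b h - c h)) / 2); first by field.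
by rewrite ss1; field.
Qed.

Definition split_pair (a : A) : B * B := (split_map 0 a, split_map 1 a).

Lemma split_pair_linear : linear split_pair.
Proof. by move=> c a b; rewrite /split_pair !linearP. Qed.

HB.instance Definition _ := GRing.isLinear.Build K A (B * B)%type _ split_pair
  split_pair_linear.

Lemma split_pairM a b :
  split_pair (namul a b) = pair_namul (split_pair a) (split_pair b).
Proof. by rewrite /split_pair !split_map_mul. Qed.

Lemma split_pair_bij : bijective split_pair.
Proof.
exists (fun bc => split_merge bc.1 bc.2) => [a|[b c]]; first exact: split_mapK.
by rewrite /split_pair; case: (split_mergeK b c) => -> ->.
Qed.

Lemma isomorphic_split : algebra_isomorphic A (B * B)%type.
Proof.
by exists split_pair; split; [exact: split_pair_bij | exact: split_pairM].
Qed.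

End Split.

(** * The weight modulo 4 and the radicals *)

Section Weight.
Variable n : nat.
Implicit Types x y : 'rV['Z_2]_n.

(** The Hamming weight, taken in [nat] because its residue modulo 4 matters, not just its parity. *)
Definition weight x : nat := (\sum_i x 0%R i)%N.
Local Notation wt := weight.

Lemma weight0 : wt 0 = 0%N.
Proof. by rewrite /wt big1 // => i _; rewrite mxE. Qed.

Lemma weight_ones : wt (ones n) = n.
Proof.
rewrite /wt -[RHS]card_ord -sum1_card; apply: eq_bigr => i _; by rewrite mxE.
Qed.

Lemma weightD_ones x : (wt (x + ones n) + wt x)%N = n.
Proof.
rewrite -[RHS]weight_ones -big_split; apply: eq_bigr => i _; rewrite !mxE.
by case: (Z2P (x 0 i)) => ->.
Qed.

(** Flipping coordinate i changes the weight by 1 - 2 x_i; the negative term is moved to the left to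
    avoid truncated subtraction. *)
Lemma weightD_delta x i : (wt (x + delta_mx 0%R i) + 2 * x 0%R i = wt x + 1)%N.
Proof.
rewrite /wt (bigD1 i) //= [in RHS](bigD1 i) //= !mxE !eqxx.
rewrite (eq_bigr (fun j => nat_of_ord (x 0 j))); last first.
  by move=> j /negPf neq_ji; rewrite !mxE neq_ji andbF addr0.
have : (nat_of_ord (x 0%R i + 1)%R + 2 * x 0%R i = x 0%R i + 1)%N.
  by case: (Z2P (x 0 i)) => ->.
rewrite (_ : (true && true)%:R = 1 :> 'Z_2) //.
by move=> wE; rewrite addnAC wE addnAC.
Qed.

Lemma weight_delta i : wt (delta_mx 0%R i) = 1%N.
Proof. by have := weightD_delta 0 i; rewrite add0r mxE weight0 addn0. Qed.

Lemma weightD_delta2 x i j : i != j ->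
  (wt (x + (delta_mx 0%R i + delta_mx 0%R j)) + 2 * x 0%R i + 2 * x 0%R j =
    wt x + 2)%N.
Proof.
move=> /negPf neq_ij; rewrite addrA.
have := weightD_delta (x + delta_mx 0%R i) j; have := weightD_delta x i.
rewrite !mxE [j == i]eq_sym neq_ij andbF addr0 => h1 h2.
by rewrite addnAC h2 addnAC h1 -addnA.
Qed.

Lemma weight_delta2 i j : i != j -> wt (delta_mx 0%R i + delta_mx 0%R j) = 2.
Proof. by move/(weightD_delta2 (0%R)); rewrite add0r !mxE weight0 !addn0. Qed.

End Weight.
Local Notation wt := weight.

Lemma Zp2_nat m : m%:R = (odd m)%:R :> 'Z_2.
Proof.
by elim: m => // m IHm; rewrite mulrSr IHm /=; case: (odd m); apply/val_inj.
Qed.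

Lemma sum_gt_lift (V : nmodType) n (i : 'I_n) (F : 'I_n.+1 -> V) :
  \sum_(j < n.+1 | (lift ord0 i < j)%N) F j
    = \sum_(j < n | (i < j)%N) F (lift ord0 j).
Proof.
by rewrite big_mkcond big_ord_recl /= add0r -big_mkcond; apply: eq_bigl.
Qed.

Lemma sum_gt0 (V : nmodType) n (F : 'I_n.+1 -> V) :
  \sum_(j < n.+1 | (@ord0 n < j)%N) F j = \sum_(j < n) F (lift ord0 j).
Proof. by rewrite big_mkcond big_ord_recl /= add0r. Qed.

(** On a 0-1 vector of weight w the k-th elementary symmetric polynomial is the binomial C(w,k),
    whose parity for k <= 3 depends only on w modulo 4. The induction uses e_k(x_0, x') = e_k(x') +
    x_0 e_(k-1)(x'). *)
Lemma elementary_symmetric_mod2 n (x : 'I_n -> 'Z_2) (w := (\sum_i x i)%N) :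
  [/\ \sum_i x i = (odd w)%:R,
      \sum_(i < n) \sum_(j < n | (i < j)%N) x i * x j = (2 <= w %% 4)%N%:R
    & \sum_(i < n) \sum_(j < n | (i < j)%N) \sum_(k < n | (j < k)%N)
        x i * x j * x k = (w %% 4 == 3)%N%:R].
Proof.
rewrite {}/w; elim: n => [|n IHn] in x *; first by rewrite !big_ord0.
have [] := IHn (fun i => x (lift ord0 i)).
rewrite !big_ord_recl !sum_gt0.
under [\sum_(i < n) \sum_(j < n.+1 | _) x _ * x j]eq_bigr
  do rewrite sum_gt_lift.
under [\sum_(j < n) \sum_(k < n.+1 | _) _]eq_bigr do rewrite sum_gt_lift.
under [\sum_(i < n) \sum_(j < n.+1 | _) \sum_(k < n.+1 | _) _]eq_bigr => i _.
  rewrite sum_gt_lift; under eq_bigr do rewrite sum_gt_lift; over.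
rewrite -mulr_sumr.
under [\sum_(j < n) \sum_(k < n | _) x ord0 * _ * _]eq_bigr => j _.
  under eq_bigr do rewrite -mulrA; rewrite -mulr_sumr; over.
rewrite -mulr_sumr => -> -> ->.
set w := (\sum_(i < n) _)%N.
case: (Z2P (x ord0)) => ->.
  by rewrite !mul0r !add0r add0n.
rewrite -(odd_mod w (erefl : odd 4 = false)).
rewrite -(odd_mod (1 + w) (erefl : odd 4 = false)).
rewrite -modnDmr; have := ltn_pmod w (isT : 0 < 4)%N.
by case: (w %% 4)%N => [|[|[|[|]]]] // _; split; apply/val_inj.
Qed.

(** * The twists M and O, the signature form and their radicals *)

Section TwistProperties.
Variable n : nat.
Implicit Types x y z : 'rV['Z_2]_n.

Lemma twist_M_add : right_additive (@twist_M n).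
Proof.
move=> x y z; rewrite /twist_M -big_split; apply: eq_bigr => i _.
rewrite -big_split; apply: eq_bigr => j _.
rewrite -big_split; apply: eq_bigr => k _; rewrite !mxE /=; ring.
Qed.

(** The identity holds triple by triple: it is the expansion of (x_i + y_i)(x_j + y_j)(x_k + y_k)
    modulo 2. *)
Lemma twist_M_pol : polarized (@twist_M n).
Proof.
move=> x y; rewrite /twist_M -!big_split; apply: eq_bigr => i _.
rewrite -!big_split; apply: eq_bigr => j _.
rewrite -!big_split; apply: eq_bigr => k _; rewrite !mxE /=.
case: (Z2P (x 0 i)) (Z2P (x 0 j)) (Z2P (x 0 k)) => -> [] -> [] ->;
case: (Z2P (y 0 i)) (Z2P (y 0 j)) (Z2P (y 0 k)) => -> [] -> [] ->;
exact/val_inj.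
Qed.

(** Each triple contributes 3 x_i x_j x_k = x_i x_j x_k, so the diagonal is e_3. *)
Lemma twist_M_diag x : twist_M x x = (wt x %% 4 == 3)%N%:R.
Proof.
have [_ _ <-] := elementary_symmetric_mod2 (x 0).
do 3! [apply: eq_bigr => ? _]; set t := _ * _ * _.
by case: (Z2P t) => ->; apply/val_inj.
Qed.

Lemma polarizedD (f g : 'rV['Z_2]_n -> 'rV['Z_2]_n -> 'Z_2) :
  polarized f -> polarized g -> polarized (fun x y => f x y + g x y).
Proof.
by move=> pf pg x y; rewrite addrACA pf pg !addrA; ring.
Qed.

Lemma right_additiveD (f g : 'rV['Z_2]_n -> 'rV['Z_2]_n -> 'Z_2) :
  right_additive f -> right_additive g ->
  right_additive (fun x y => f x y + g x y).
Proof. by move=> af ag x y z; rewrite af ag addrACA. Qed.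

Lemma bilinear_polarized (g : 'rV['Z_2]_n -> 'rV['Z_2]_n -> 'Z_2) :
  right_additive g -> right_additive (fun x y => g y x) -> polarized g.
Proof.
move=> gr gl x y; rewrite gr !(gl _ x y).
case: (Z2P (g x x)) (Z2P (g y y)) (Z2P (g x y)) (Z2P (g y x))
  => -> [] -> [] -> [] ->;
exact/val_inj.
Qed.

Definition upper_form x y :=
  \sum_(i < n) \sum_(j < n | (i <= j)%N) x 0 i * y 0 j.

Lemma upper_form_addr : right_additive upper_form.
Proof.
move=> x y z; rewrite /upper_form -big_split; apply: eq_bigr => i _.
by rewrite -big_split; apply: eq_bigr => j _; rewrite mxE mulrDr.
Qed.

Lemma upper_form_addl : right_additive (fun x y => upper_form y x).
Proof.
move=> x y z; rewrite /upper_form -big_split; apply: eq_bigr => i _.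
by rewrite -big_split; apply: eq_bigr => j _; rewrite mxE mulrDl.
Qed.

Lemma twist_O_add : right_additive (@twist_O n).
Proof. exact: right_additiveD twist_M_add upper_form_addr. Qed.

Lemma twist_O_pol : polarized (@twist_O n).
Proof.
exact: polarizedD twist_M_pol (bilinear_polarized upper_form_addr
  upper_form_addl).
Qed.

(** The diagonal is e_1 + e_2 + e_3, since x_i^2 = x_i; this is 0 for weight 0 modulo 4 and 1 for
    the three other residues. *)
Lemma twist_O_diag x : twist_O x x = (wt x %% 4 != 0)%N%:R.
Proof.
rewrite /twist_O twist_M_diag.
have -> : \sum_(i < n) \sum_(j < n | (i <= j)%N) x 0 i * x 0 j =
    \sum_i x 0 i + \sum_(i < n) \sum_(j < n | (i < j)%N) x 0 i * x 0 j.
  rewrite -big_split; apply: eq_bigr => i _; rewrite (bigD1 i) //=;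
    congr (_ + _).
    by case: (Z2P (x 0 i)) => ->; apply/val_inj.
  by apply: eq_bigl => j; rewrite [RHS]ltn_neqAle andbC eq_sym.
have [-> -> _] := elementary_symmetric_mod2 (x 0); rewrite -/(wt x).
have -> : odd (wt x) = odd (wt x %% 4) by rewrite odd_mod.
have := ltn_pmod (wt x) (isT : 0 < 4)%N.
by case: (wt x %% 4)%N => [|[|[|[|]]]] //; move=> _; apply/val_inj.
Qed.

Section Sig.
Variable p : nat.

Lemma twist_sigC x y : twist_sig p x y = twist_sig p y x.
Proof. by apply: eq_bigr => i _; rewrite mulrC. Qed.

Lemma twist_sig_add : right_additive (@twist_sig p n).
Proof.
move=> x y z; rewrite /twist_sig -big_split; apply: eq_bigr => i _.
by rewrite mxE mulrDr.
Qed.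

Lemma twist_sig_pol : polarized (@twist_sig p n).
Proof.
apply: bilinear_polarized; first exact: twist_sig_add.
by move=> x y z; rewrite !(twist_sigC _ x) twist_sig_add.
Qed.

Lemma twist_sig_ones : (p <= n)%N -> twist_sig p (ones n) (ones n) = (odd p)%:R.
Proof.
move=> le_pn; rewrite -Zp2_nat -[in RHS](card_ord p) -sumr_const /twist_sig.
by rewrite [RHS](big_ord_widen n (fun=> 1)) //; apply: eq_bigr => i _;
  rewrite !mxE mulr1.
Qed.

(** The signature form is symmetric, so it changes squares but not commutation: the real algebras
    have the radicals of the complex ones. *)
Lemma radical_sig f z :
  radical (fun x y => f x y + twist_sig p x y) z <-> radical f z.
Proof.
split=> rad_z x; last by rewrite rad_z twist_sigC.
by have := rad_z x; rewrite twist_sigC => /addIr.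
Qed.
End Sig.

(** By polarization, u_z commutes with u_x exactly when the diagonal is additive at (z, x); on
    booleans [!=] is addition modulo 2. *)
Lemma radicalP f (a : nat -> bool) z : polarized f ->
    (forall x, f x x = (a (wt x))%:R) ->
  radical f z <-> forall x, a (wt (z + x)) = (a (wt z) != a (wt x)).
Proof.
move=> f_pol f_diag; split=> rad_z x.
  have := f_pol z x; rewrite rad_z !f_diag.
  by case: (Z2P (f z x)) => ->; case: (a _) (a _) (a _) =>
    [] [] [] /(congr1 val).
have := f_pol z x; rewrite !f_diag rad_z.
case: (Z2P (f z x)) (Z2P (f x z)) => -> [] -> //;
by case: (a _) (a _) => [] [] /(congr1 val).
Qed.

(* Only x of weight 1 and 2 are needed: the second alternative lists the
   constraints obtained when z has both a zero and a nonzero coordinate. *)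
Lemma weight_coboundary (a : pred nat) z (w := wt z) : (2 < n)%N -> z != 0 ->
    (forall x, a (wt (z + x)) = (a w != a (wt x))) ->
    [/\ z = ones n, a n.-1 = (a n != a 1%N) & a n.-2 = (a n != a 2)]
  \/ [/\ (0 < w)%N, a w.-1 = (a w != a 1%N), a w.+1 = (a w != a 1%N),
          a w = (a w != a 2)
        & a w.+2 = (a w != a 2) \/ (1 < w)%N /\ a w.-2 = (a w != a 2)].
Proof.
move=> n3 z0 beta.
have nat1 : nat_of_ord (1 : 'Z_2) = 1%N by [].
have nat0 : nat_of_ord (0 : 'Z_2) = 0%N by [].
have beta1 i : exists2 v, (v + 2 * z 0%R i = w + 1)%N & a v = (a w != a 1%N).
  by exists (wt (z + delta_mx 0 i)); rewrite ?weightD_delta // beta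
    weight_delta.
have beta2 i j : i != j ->
    exists2 v, (v + 2 * z 0%R i + 2 * z 0%R j = w + 2)%N & a v = (a w != a 2).
  move=> neq_ij; exists (wt (z + (delta_mx 0 i + delta_mx 0 j))).
    by rewrite weightD_delta2.
  by rewrite beta weight_delta2.
have [i zi] : exists i, z 0 i = 1.
  apply: contrapT => none; case/eqP: z0; apply/rowP=> i; rewrite mxE.
  by case: (Z2P (z 0 i)) => // zi; case: none; exists i.
(* Used to pick two further coordinates j and k, which exist since n > 2. *)
have outside (s : seq 'I_n) : (size s < n)%N -> exists l, l \notin s.
  move=> s_n; apply: contrapT => none; move: s_n; apply/negP; rewrite -leqNgt.
  rewrite -[leqLHS]card_ord; apply: leq_trans (card_size s);
    apply/subset_leq_card/fintype.subsetP => l _.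
  by apply: contrapT => /negP l_s; case: none; exists l.
have [j] := outside [:: i] (ltnW n3); rewrite inE => neq_ji.
have [k] := outside [:: i; j] n3; rewrite !inE negb_or => /andP[neq_ki neq_kj].
have [[l zl]|none] := pselect (exists l, z 0 l = 0); last first.
  have zE : z = ones n.
    apply/rowP=> l; rewrite mxE; case: (Z2P (z 0 l)) => // zl.
    by case: none; exists l.
  left; have wE : w = n by rewrite /w zE weight_ones.
  move: (beta1 i) (beta2 j i neq_ji); rewrite zE wE !mxE nat1 =>
    -[v1 v1E <-] [v2 v2E <-].
  by split=> //; congr a; lia.
right; clearbody w.
have neq_li : l != i by apply/eqP=> li; move: zl; rewrite li zi.
have [m neq_mi neq_ml] : exists2 m, m != i & m != l.
  by have [jl|] := eqVneq j l; [exists k; rewrite // -jl | exists j].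
case: (beta1 i) => v1; rewrite zi nat1 => v1E av1.
case: (beta1 l) => v2; rewrite zl nat0 => v2E av2.
case: (beta2 l i neq_li) => v3; rewrite zl zi nat0 nat1 => v3E av3.
(* The third coordinate m agrees with l (value 0) or with i (value 1); flipping that equal pair
   moves the weight by 2 up or down. *)
have [v4 v4E av4] : exists2 v, (v = w.+2 \/ v + 2 = w)%N & a v = (a w != a 2).
  case: (Z2P (z 0 m)) => zm.
    case: (beta2 m l neq_ml) => v; rewrite zl zm nat0 => vE av; exists v => //;
      left; clear -vE; lia.
  case: (beta2 m i neq_mi) => v; rewrite zi zm nat1 => vE av; exists v => //;
    right; clear -vE; lia.
split; [clear -v1E; lia | rewrite -av1 | rewrite -av2 | rewrite -av3 |
  rewrite -av4].
- by congr a; clear -v1E; lia.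
- by congr a; clear -v2E; lia.
- by congr a; clear -v3E; lia.
- clear -v4E; case: v4E => v4E; [left | right; split; first lia];
  by congr a; lia.
Qed.

(** As [a 1] and [a 2] are false, [a] would be constant on w - 1, w, w + 1, which forces w = 1
    modulo 4; but then w + 2 and w - 2 are 3 modulo 4. *)
Lemma eq3_mod4_no_period w (a := fun w => (w %% 4 == 3)%N) :
  (0 < w)%N -> a w.-1 = (a w != a 1%N) -> a w.+1 = (a w != a 1%N) ->
  ~ (a w.+2 = (a w != a 2) \/ (1 < w)%N /\ a w.-2 = (a w != a 2)).
Proof.
rewrite {}/a /=; have : w = (4 * (w %/ 4) + w %% 4)%N by rewrite mulnC -divn_eq.
have := ltn_pmod w (isT : 0 < 4)%N.
by move: (w %/ 4)%N => q; case: (w %% 4)%N => [|[|[|[|//]]]] _ ->; lia.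
Qed.

Lemma radical_M z : (2 < n)%N -> radical (@twist_M n) z ->
  z = 0 \/ z = ones n /\ (n %% 4 = 2)%N.
Proof.
move=> n3 /(@radicalP _ (fun w => w %% 4 == 3)%N _ twist_M_pol twist_M_diag)
  rad_z.
have [|z0] := eqVneq z 0; [by left | right].
case: (@weight_coboundary (fun w => w %% 4 == 3)%N _ n3 z0 rad_z) => /=;
  clear rad_z.
  (* None of n, n - 1, n - 2 may be 3 modulo 4, which leaves n = 2 modulo 4. *)
  by case=> -> h1 h2; split=> //; clear -n3 h1 h2; lia.
by case=> w_gt0 h1 h2 _ h4; case: (eq3_mod4_no_period w_gt0 h1 h2 h4).
Qed.

Lemma radical_O z : (2 < n)%N -> radical (@twist_O n) z ->
  z = 0 \/ z = ones n /\ (n %% 4 = 0)%N.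
Proof.
move=> n3 /(@radicalP _ (fun w => w %% 4 != 0)%N _ twist_O_pol twist_O_diag)
  rad_z.
have [|z0] := eqVneq z 0; [by left | right].
case: (@weight_coboundary (fun w => w %% 4 != 0)%N _ n3 z0 rad_z) => /=;
  clear rad_z.
  by case=> -> h1 h2; split=> //; clear -n3 h1 h2; lia.
(* Since [a 2] is true here, the condition from flipping a zero and a one says that a boolean equals
   its negation. *)
by case=> _ _ _; case: (_ != 0)%N.
Qed.

(** Adding [ones] sends the weight w to 2 - w modulo 4, which fixes the residue 3. *)
Lemma radical_ones_M : (n %% 4 = 2)%N -> radical (@twist_M n) (ones n).
Proof.
move=> n4; apply/(@radicalP _ (fun w => w %% 4 == 3)%N _ twist_M_pol
  twist_M_diag) => x.
rewrite weight_ones addrC n4; move: n4;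
rewrite -[in (n %% 4)%N](weightD_ones x) -modnDm.
have := ltn_pmod (wt x) (isT : 0 < 4)%N.
have := ltn_pmod (wt (x + ones n)) (isT : 0 < 4)%N.
by case: (_ %% 4)%N => [|[|[|[|]]]] //; case: (_ %% 4)%N => [|[|[|[|]]]].
Qed.

(** Adding [ones] negates the weight modulo 4, which preserves being nonzero. *)
Lemma radical_ones_O : (n %% 4 = 0)%N -> radical (@twist_O n) (ones n).
Proof.
move=> n4; apply/(@radicalP _ (fun w => w %% 4 != 0)%N _ twist_O_pol
  twist_O_diag) => x.
rewrite weight_ones addrC n4; move: n4;
rewrite -[in (n %% 4)%N](weightD_ones x) -modnDm.
have := ltn_pmod (wt x) (isT : 0 < 4)%N.
have := ltn_pmod (wt (x + ones n)) (isT : 0 < 4)%N.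
by case: (_ %% 4)%N => [|[|[|[|]]]] //; case: (_ %% 4)%N => [|[|[|[|]]]].
Qed.

End TwistProperties.

(** * Simplicity criteria and splittings of the algebras *)

Lemma sum_ge_lift (V : nmodType) n (i : 'I_n) (F : 'I_n.+1 -> V) :
  \sum_(j < n.+1 | (lift ord0 i <= j)%N) F j
    = \sum_(j < n | (i <= j)%N) F (lift ord0 j).
Proof.
by rewrite big_mkcond big_ord_recl /= add0r -big_mkcond; apply: eq_bigl.
Qed.

Lemma restrict_twist_M n : restrict_twist (@twist_M n.+1) =2 @twist_M n.
Proof.
move=> h k; rewrite /restrict_twist /twist_M big_ord_recl sum_gt0 big1 =>
  [|j _].
  rewrite add0r; apply: eq_bigr => i _; rewrite sum_gt_lift;
    apply: eq_bigr => j _.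
  by rewrite sum_gt_lift; apply: eq_bigr => l _; rewrite !ext0_lift.
by rewrite sum_gt_lift big1 // => l _; rewrite !ext0_ord0 !mul0r !addr0.
Qed.

Lemma restrict_twist_O n : restrict_twist (@twist_O n.+1) =2 @twist_O n.
Proof.
move=> h k; rewrite /restrict_twist /twist_O -(restrict_twist_M h k);
  congr (_ + _).
rewrite big_ord_recl big1 ?add0r => [|j _]; last by rewrite ext0_ord0 mul0r.
by apply: eq_bigr => i _; rewrite sum_ge_lift; apply: eq_bigr => j _;
  rewrite !ext0_lift.
Qed.

(** The boolean [c] records whether [ones] is radical. The condition on squares is requested only
    when u_1^2 = -1, so it is vacuous for the complex algebras, where a radical u_1 has square 1. *)
Lemma simple_twist_iff (K : numFieldType) n
    (f : 'rV['Z_2]_n -> 'rV['Z_2]_n -> 'Z_2) (c : bool) :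
    (2 < n)%N -> right_additive f -> polarized f ->
    (c -> radical f (ones n)) ->
    (forall z, radical f z -> z = 0 \/ z = ones n /\ c) ->
    (c -> f (ones n) (ones n) = 1 ->
      forall x y : K, x != 0 -> x ^+ 2 + y ^+ 2 != 0) ->
  simple_algebra (twisted_group_algebra K f)
    <-> ~~ (c && (f (ones n) (ones n) == 0)).
Proof.
case: n f => // n f _ f_add f_pol rad1 radE sqK; split=> [simp|].
  apply/andP=> -[/rad1 rad_1 /eqP f11].
  exact: not_simple_split f_add f_pol rad_1 f11 _ simp.
case: c => /= in rad1 radE sqK *; last first.
  by move=> _; apply: simple_radical0 => // z /radE[|[_ ]].
case: (Z2P (f (ones _) (ones _))) => f11; first by rewrite f11.
move=> _; apply: (simple_radical_sq f_add f_pol f11); first exact: sqK isT f11.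
by move=> w /radE[|[]]; [left | right].
Qed.

Lemma sqr_sum_neq0 (R : realFieldType) (x y : R) :
  x != 0 -> x ^+ 2 + y ^+ 2 != 0.
Proof. by move=> x0; rewrite gt_eqF // ltr_pwDl ?sqr_ge0 // exprn_even_gt0. Qed.

Lemma twist_O_ones n : (n %% 4 = 0)%N -> twist_O (ones n) (ones n) = 0.
Proof. by move=> n4; rewrite twist_O_diag weight_ones n4. Qed.

Lemma twist_M_ones n : (n %% 4 = 2)%N -> twist_M (ones n) (ones n) = 0.
Proof. by move=> n4; rewrite twist_M_diag weight_ones n4. Qed.

Lemma simple_algO_iff (R : realType) n : (2 < n)%N ->
  simple_algebra (algO R n) <-> (n %% 4 != 0)%N.
Proof.
move=> n3; have [] := @simple_twist_iff R[i] n (@twist_O n) (n %% 4 == 0)%N n3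
  (@twist_O_add n) (@twist_O_pol n).
- by move/eqP; apply: radical_ones_O.
- by move=> z /(radical_O n3)[|[-> ->]]; [left | right].
- by move/eqP/twist_O_ones => ->.
by case: eqP => [/twist_O_ones->|_].
Qed.

Lemma simple_algM_iff (R : realType) n : (2 < n)%N ->
  simple_algebra (algM R n) <-> (n %% 4 != 2)%N.
Proof.
move=> n3; have [] := @simple_twist_iff R[i] n (@twist_M n) (n %% 4 == 2)%N n3
  (@twist_M_add n) (@twist_M_pol n).
- by move/eqP; apply: radical_ones_M.
- by move=> z /(radical_M n3)[|[-> ->]]; [left | right].
- by move/eqP/twist_M_ones => ->.
by case: eqP => [/twist_M_ones->|_].
Qed.

(** When 4 divides p + q, [twist_O] vanishes at [ones], so u_1^2 = (-1)^p comes from the signature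
    form alone. *)
Lemma simple_algOpq_iff (R : realType) p q : (2 < p + q)%N ->
  simple_algebra (algOpq R p q) <-> ~~ (((p + q) %% 4 == 0)%N && ~~ odd p).
Proof.
move=> n3; have [] := @simple_twist_iff R (p + q) _ ((p + q) %% 4 == 0)%N n3
  (right_additiveD (@twist_O_add _) (@twist_sig_add _ p))
  (polarizedD (@twist_O_pol _) (@twist_sig_pol _ p)).
- by move/eqP => n4; apply/radical_sig; apply: radical_ones_O.
- by move=> z /radical_sig/(radical_O n3)[|[-> ->]]; [left | right].
- by move=> _ _; apply: sqr_sum_neq0.
rewrite twist_sig_ones ?leq_addr //.
by case: eqP => [/twist_O_ones->|_]; rewrite ?add0r; case: (odd p).
Qed.

Lemma simple_algMpq_iff (R : realType) p q : (2 < p + q)%N ->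
  simple_algebra (algMpq R p q) <-> ~~ (((p + q) %% 4 == 2)%N && ~~ odd p).
Proof.
move=> n3; have [] := @simple_twist_iff R (p + q) _ ((p + q) %% 4 == 2)%N n3
  (right_additiveD (@twist_M_add _) (@twist_sig_add _ p))
  (polarizedD (@twist_M_pol _) (@twist_sig_pol _ p)).
- by move/eqP => n4; apply/radical_sig; apply: radical_ones_M.
- by move=> z /radical_sig/(radical_M n3)[|[-> ->]]; [left | right].
- by move=> _ _; apply: sqr_sum_neq0.
rewrite twist_sig_ones ?leq_addr //.
by case: eqP => [/twist_M_ones->|_]; rewrite ?add0r; case: (odd p).
Qed.

Lemma algO_split (R : realType) n : (n.+1 %% 4 = 0)%N ->
  algebra_isomorphic (algO R n.+1) (algO R n * algO R n)%type.
Proof.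
move=> n4; rewrite /algO.
(* The twist is a parameter of the algebra type, so an equality of functions is needed rather than a
   pointwise one. *)
have <- : restrict_twist (@twist_O n.+1) = @twist_O n.
  by apply/funext=> h; apply/funext=> k; apply: restrict_twist_O.
apply: isomorphic_split; [exact: twist_O_add | exact: twist_O_pol | |
  exact: twist_O_ones].
exact: radical_ones_O.
Qed.

Lemma algM_split (R : realType) n : (n.+1 %% 4 = 2)%N ->
  algebra_isomorphic (algM R n.+1) (algM R n * algM R n)%type.
Proof.
move=> n4; rewrite /algM.
have <- : restrict_twist (@twist_M n.+1) = @twist_M n.
  by apply/funext=> h; apply/funext=> k; apply: restrict_twist_M.
apply: isomorphic_split; [exact: twist_M_add | exact: twist_M_pol | |
  exact: twist_M_ones].
exact: radical_ones_M.
Qed.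

Lemma exists_4m n : (exists m, n = (4 * m)%N) <-> (n %% 4 = 0)%N.
Proof.
split=> [[m ->]|n4]; first by rewrite modnMr.
by exists (n %/ 4)%N; rewrite {1}(divn_eq n 4) n4 addn0 mulnC.
Qed.

Lemma exists_4m2 n : (exists m, n = (4 * m + 2)%N) <-> (n %% 4 = 2)%N.
Proof.
split=> [[m ->]|n4]; first by rewrite mulnC modnMDl.
by exists (n %/ 4)%N; rewrite {1}(divn_eq n 4) n4 mulnC.
Qed.

Theorem theorem3 (R : realType) :
  [/\ (forall n : nat, (3 <= n)%N ->
         (simple_algebra (algO R n) <-> ~ (exists m : nat, n = (4 * m)%N))
         /\ (simple_algebra (algM R n)
               <-> ~ (exists m : nat, n = (4 * m + 2)%N)))
      /\ (forall m : nat, (1 <= m)%N ->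
         algebra_isomorphic (algO R (4 * m))
           (algO R (4 * m - 1) * algO R (4 * m - 1))%type
         /\ algebra_isomorphic (algM R (4 * m + 2))
           (algM R (4 * m + 1) * algM R (4 * m + 1))%type),
      (forall p q : nat, (3 <= p + q)%N ->
         (simple_algebra (algOpq R p q) <->
            (~ (exists m : nat, (p + q = 4 * m)%N))
            \/ ((exists m : nat, (p + q = 4 * m)%N) /\ odd p /\ odd q)))
    & (forall p q : nat, (3 <= p + q)%N ->
         (simple_algebra (algMpq R p q) <->
            (~ (exists m : nat, (p + q = 4 * m + 2)%N))
            \/ ((exists m : nat, (p + q = 4 * m + 2)%N) /\ odd p /\ odd q)))].
Proof.
split.
- split=> [n n3|m m1].
    split.
      by apply: iff_trans (simple_algO_iff R n3) _;
        split=> [/eqP n4 /exists_4m|n4]; last apply/eqP=> /exists_4m.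
    by apply: iff_trans (simple_algM_iff R n3) _;
      split=> [/eqP n4 /exists_4m2|n4]; last apply/eqP=> /exists_4m2.
  split.
    (* [algO_split] expects a successor; m >= 1 provides it. *)
    have -> : (4 * m = (4 * m.-1 + 3).+1)%N by lia.
    by rewrite subn1 /=; apply: algO_split; lia.
  by rewrite addn2 addn1; apply: algM_split; lia.
- move=> p q n3; apply: iff_trans (simple_algOpq_iff R n3) _.
  (* As p + q is even, the parity of p alone settles that of q. *)
  have parity : ((p + q) %% 4 = 0)%N -> odd q = odd p.
    by move/(congr1 odd); rewrite odd_mod // oddD;
      case: (odd p) (odd q) => [] [].
  rewrite negb_and negbK; split=> [/orP[/eqP n4|p_odd]|[n4|[_ [-> _]]]];
    last exact: orbT.
  + by left=> /exists_4m.
  + have [/eqP n4|/eqP n4] := boolP ((p + q) %% 4 == 0)%N;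
    last by left=> /exists_4m.
    by right; rewrite parity // p_odd; split=> //; apply/exists_4m.
  + by apply/orP; left; apply/eqP=> /exists_4m.
- move=> p q n3; apply: iff_trans (simple_algMpq_iff R n3) _.
  have parity : ((p + q) %% 4 = 2)%N -> odd q = odd p.
    by move/(congr1 odd); rewrite odd_mod // oddD;
      case: (odd p) (odd q) => [] [].
  rewrite negb_and negbK; split=> [/orP[/eqP n4|p_odd]|[n4|[_ [-> _]]]];
    last exact: orbT.
  + by left=> /exists_4m2.
  + have [/eqP n4|/eqP n4] := boolP ((p + q) %% 4 == 2)%N;
    last by left=> /exists_4m2.
    by right; rewrite parity // p_odd; split=> //; apply/exists_4m2.
  + by apply/orP; left; apply/eqP=> /exists_4m2.
Qed.
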